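(* Let $p\neq 3$ be a prime, let $F_2=\langle x_1,x_2\rangle$ be the free group on two generators with pro-$p$ completion $\hat F_{2,p}$, and let $H_3=\mathbb Z/3$ act on $F_2$ (hence on $\hat F_{2,p}$) with generator $1\in\mathbb Z/3$ acting by $x_1\mapsto x_2^{-1}$, $x_2\mapsto x_1x_2^{-1}$. Then $\hat F_{2,p}\rtimes H_3$ is the unique $\mathbf C_{\pm3^2}$ $p$-Nielsen class limit.
   Context: $\mathbf C_{\pm3^2}$ denotes two repetitions of each of the two nontrivial conjugacy classes of $H_3=\mathbb Z/3$ (four classes in all). For $p\neq3$ and $U$ a finite $p$-group with $H_3$ action, each nontrivial class of $H_3$ lifts uniquely to a conjugacy class of elements of order 3 in $U\rtimes H_3$, and $\mathbf C_{\pm 3^2}$ also denotes the resulting 4-tuple of classes of $U\rtimes H_3$. For a finite group $G$ and an $r$-tuple $\mathbf C$ of conjugacy classes, the Nielsen class $\mathrm{Ni}(G,\mathbf C)$ is the set of $(g_1,\dots,g_r)\in G^r$ with $g_1\cdots g_r=1$, $\langle g_1,\dots,g_r\rangle=G$, and the $g_i$ lying, in some order and with multiplicity, in the classes of $\mathbf C$. $p$-Nielsen class limits. Let $p\neq3$. Consider infinite projective systems $\{U_i\}_{i\in I}$ of distinct finite $p$-group quotients of $F_2$ by $H_3$-stable normal subgroups (so $H_3$ acts on each $U_i$), such that $\mathrm{Ni}(U_i\rtimes H_3,\mathbf C_{\pm3^2})\neq\emptyset$ for all $i$. Put $G_{p,I}=\varprojlim_i U_i\rtimes H_3$; then $\mathrm{Ni}(G_{p,I},\mathbf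 C_{\pm3^2})=\varprojlim_i \mathrm{Ni}(U_i\rtimes H_3,\mathbf C_{\pm3^2})$ is nonempty. A $\mathbf C_{\pm3^2}$ $p$-Nielsen class limit is a maximal such group $G_{p,I}$, where maximality is among such groups viewed as quotients of $\hat F_{2,p}\rtimes H_3$ (larger meaning having the other as a quotient). *)

(* Defs.v *)
From HB Require Import structures.
From mathcomp Require Import all_boot fingroup perm zmodp.
From mathcomp Require Import boolp classical_sets functions cardinality.
(* Shadows fingroup.repr *)
Import generic_quotient.

Set Implicit Arguments.
Unset Strict Implicit.
Unset Printing Implicit Defensive.

Local Open Scope group_scope.
Local Open Scope quotient_scope.

(* The unital magma morphisms between two groups are the group
   homomorphisms. *)
Notation "{ 'hom' G -> H }" := (UMagmaMorphism.type G%type H%type)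
  (at level 0, G at level 98, H at level 99, format "{ 'hom'  G  ->  H }")
  : type_scope.

Section FreeGroup.
Variable T : choiceType.

(* The letter (t, b) stands for t if b is false, for its inverse if b is
   true. *)
Definition letter : choiceType := (T * bool)%type.

Definition linv (a : letter) : letter := (a.1, ~~ a.2).

Definition reduced (w : seq letter) : bool :=
  sorted (fun a b => b != linv a) w.

Record free_group := FreeGroup { fg_word :> seq letter; _ : reduced fg_word }.

HB.instance Definition _ := [isSub for fg_word].
HB.instance Definition _ := [Choice of free_group by <:].

Definition lcons (a : letter) (w : seq letter) : seq letter :=
  if w is b :: w' then if b == linv a then w' else a :: w else [:: a].

Definition wmul (u v : seq letter) : seq letter := foldr lcons v u.

Definition winv (u : seq letter) : seq letter := rev (map linv u).

Lemma linvK : involutive linv.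
Proof. by case=> t b; rewrite /linv /= negbK. Qed.

Lemma reduced_lcons a w : reduced w -> reduced (lcons a w).
Proof.
case: w => [//|b w] /= rw; case: eqP => [_|/eqP ne] /=; last by rewrite ne.
exact: path_sorted rw.
Qed.

Lemma lconsK a w : reduced w -> lcons (linv a) (lcons a w) = w.
Proof.
case: w => [_|b w] /=; first by rewrite linvK eqxx.
case: (eqVneq b (linv a)) => [->|ne] rw; last by rewrite /= linvK eqxx.
by case: w rw => [//|c w] /= /andP[/negPf->].
Qed.

Lemma reduced_wmul u v : reduced v -> reduced (wmul u v).
Proof. by move=> rv; elim: u => //= a u IH; apply: reduced_lcons. Qed.

Lemma wmul_lcons a u v : reduced v -> wmul (lcons a u) v = lcons a (wmul u v).
Proof.
move=> rv; case: u => [//|b u] /=; case: eqP => [->|//] /=.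
by rewrite -{1}[a]linvK lconsK // reduced_wmul.
Qed.

Lemma wmulA u v w : reduced w -> wmul u (wmul v w) = wmul (wmul u v) w.
Proof. by move=> rw; elim: u => //= a u ->; rewrite wmul_lcons. Qed.

Lemma wmul_nil u : reduced u -> wmul u [::] = u.
Proof.
elim: u => // a u IH /= pu; rewrite IH; last exact: path_sorted pu.
by case: u pu {IH} => //= b u /andP[/negPf->].
Qed.

Lemma reduced_winv u : reduced u -> reduced (winv u).
Proof.
rewrite /reduced /winv rev_sorted sorted_map.
apply: sub_sorted => a b /=; apply: contraNN => /eqP ab.
by rewrite -[b]linvK -ab.
Qed.

Lemma winvK : involutive winv.
Proof. by move=> u; rewrite /winv map_rev revK mapK //; exact: linvK. Qed.

Lemma wmulVw u : wmul (winv u) u = [::].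
Proof.
elim: u => //= a u IH.
by rewrite /winv /= rev_cons /wmul foldr_rcons /= linvK eqxx.
Qed.

Definition fg_one : free_group := @FreeGroup [::] isT.
Definition fg_mul (u v : free_group) : free_group :=
  FreeGroup (@reduced_wmul u v (valP v)).
Definition fg_inv (u : free_group) : free_group :=
  FreeGroup (reduced_winv (valP u)).

Lemma fg_mulA : associative fg_mul.
Proof.
by move=> u v w; apply: val_inj; rewrite /= wmulA //; apply: (valP w).
Qed.
Lemma fg_mul1g : left_id fg_one fg_mul.
Proof. by move=> u; apply: val_inj. Qed.
Lemma fg_mulg1 : right_id fg_one fg_mul.
Proof.
by move=> u; apply: val_inj; rewrite /= wmul_nil //; apply: (valP u).
Qed.
Lemma fg_mulVg : left_inverse fg_one fg_inv fg_mul.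
Proof. by move=> u; apply: val_inj; rewrite /= wmulVw. Qed.
Lemma fg_mulgV : right_inverse fg_one fg_inv fg_mul.
Proof. by move=> u; apply: val_inj; rewrite /= -{1}[fg_word u]winvK wmulVw. Qed.

HB.instance Definition _ := isGroup.Build free_group
  fg_mulA fg_mul1g fg_mulg1 fg_mulVg fg_mulgV.

Definition fgen (t : T) : free_group := @FreeGroup [:: (t, false)] isT.

Section Lift.
Variables (G : groupType) (f : T -> G).

Definition letter_val (a : letter) : G := if a.2 then (f a.1)^-1 else f a.1.

Definition fg_lift (w : free_group) : G :=
  foldr (fun a g => letter_val a * g) 1 w.

Lemma letter_valV a : letter_val (linv a) = (letter_val a)^-1.
Proof. by case: a => t [] //=; rewrite /letter_val /= invgK. Qed.

Lemma fg_lift_lcons a w :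
  foldr (fun a g => letter_val a * g) 1 (lcons a w)
  = letter_val a * foldr (fun a g => letter_val a * g) 1 w.
Proof.
case: w => [//|b w] /=; case: eqP => [->|//] /=.
by rewrite letter_valV mulKVg.
Qed.

Lemma fg_liftM : {morph fg_lift : u v / u * v}.
Proof.
move=> [u ru] [v rv]; rewrite /fg_lift /= {ru rv}.
by elim: u => [|a u IH] /=; rewrite ?mul1g // fg_lift_lcons IH mulgA.
Qed.

Lemma fg_lift1 : fg_lift 1 = 1. Proof. by []. Qed.

HB.instance Definition _ := isUMagmaMorphism.Build
  free_group G fg_lift (pair fg_lift1 fg_liftM).

Lemma fg_lift_gen t : fg_lift (fgen t) = f t.
Proof. by rewrite /fg_lift /= /letter_val /= mulg1. Qed.

End Lift.

Lemma fg_hom_ext (G : groupType) (h k : {hom free_group -> G}) :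
  (forall t, h (fgen t) = k (fgen t)) -> h =1 k.
Proof.
move=> hk [w rw]; elim: w rw => [|[t b] w IH] rw.
  by rewrite (_ : FreeGroup rw = 1) ?gmulf1 //; apply: val_inj.
have rw' : reduced w := path_sorted rw.
rewrite (_ : FreeGroup rw =
    (if b then (fgen t)^-1 else fgen t) * FreeGroup rw'); last first.
  apply: val_inj; case: b rw => rw /=.
    by case: w rw rw' {IH} => //= c w /andP[/negPf-> _].
  by case: w rw rw' {IH} => //= c w /andP[/negPf-> _].
by rewrite !gmulfM IH; case: b {rw}; rewrite ?gmulfV hk.
Qed.

End FreeGroup.

Definition F2 : groupType := free_group 'I_2.
Definition x1 : F2 := fgen ord0.
Definition x2 : F2 := fgen ord_max.

(* The action of 1 in Z/3 on F2. *)
Definition sigma : {hom F2 -> F2} :=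
  fg_lift (fun t : 'I_2 => if t == ord0 then x2^-1 else x1 * x2^-1).

Lemma sigma_x1 : sigma x1 = x2^-1. Proof. exact: fg_lift_gen. Qed.
Lemma sigma_x2 : sigma x2 = x1 * x2^-1. Proof. exact: fg_lift_gen. Qed.

Lemma sigma3 w : sigma (sigma (sigma w)) = w.
Proof.
pose s3 : {hom F2 -> F2} := sigma \o (sigma \o sigma).
apply: (@fg_hom_ext _ _ s3 idfun) => t {w}.
have [->|->] : t = ord0 \/ t = ord_max.
- by case: t => [[|[|//]] ?]; [left|right]; apply: val_inj.
- change (sigma (sigma (sigma x1)) = x1).
  rewrite sigma_x1 gmulfV sigma_x2 invgM invgK gmulfM gmulfV.
  by rewrite sigma_x1 sigma_x2 mulgK.
change (sigma (sigma (sigma x2)) = x2).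
rewrite sigma_x2 [sigma (x1 * _)]gmulfM gmulfV sigma_x1 sigma_x2.
by rewrite invgM invgK mulKg gmulfV sigma_x1 invgK.
Qed.

Record normal_subgroup (G : groupType) := NormalSubgroup {
  ns_pred :> {pred G};
  ns_group : group_closed ns_pred;
  ns_conj : forall x y, x \in ns_pred -> x ^ y \in ns_pred
}.

Section Quotient.
Variables (G : groupType) (N : normal_subgroup G).

Definition coset_rel (x y : G) : bool := x^-1 * y \in N.

Lemma coset_rel_refl : reflexive coset_rel.
Proof. by move=> x; rewrite /coset_rel mulVg (ns_group N).1. Qed.

Lemma coset_rel_sym : symmetric coset_rel.
Proof.
move=> x y; rewrite /coset_rel; apply/idP/idP => h;
by rewrite -[X in X \in _]invgK invgM invgK (group_closedV (ns_group N)).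
Qed.

Lemma coset_rel_trans : transitive coset_rel.
Proof.
move=> y x z hxy hyz; rewrite /coset_rel.
rewrite (_ : x^-1 * z = (x^-1 * y) * (y^-1 * z)); last by rewrite -mulgA mulKVg.
exact: (group_closedM (ns_group N)).
Qed.

Canonical coset_equiv :=
  EquivRel coset_rel coset_rel_refl coset_rel_sym coset_rel_trans.

Definition quot := {eq_quot coset_equiv}.
HB.instance Definition _ := Choice.on quot.
HB.instance Definition _ := Quotient.on quot.
HB.instance Definition _ : EqQuotient _ coset_equiv quot := EqQuotient.on quot.

Definition quot_one : quot := \pi_quot 1.
Definition quot_mul (u v : quot) : quot := \pi_quot (repr u * repr v).
Definition quot_inv (u : quot) : quot := \pi_quot (repr u)^-1.

Lemma quot_eqP x y : reflect (\pi_quot x = \pi_quot y) (x^-1 * y \in N).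
Proof. exact: (@eqquotP _ _ quot x y). Qed.

Lemma quot_ind (P : quot -> Prop) : (forall x, P (\pi_quot x)) -> forall u, P u.
Proof. by move=> Px u; rewrite -[u]reprK. Qed.

Lemma repr_quot x : x^-1 * repr (\pi_quot x) \in N.
Proof. by apply/quot_eqP; rewrite reprK. Qed.

Lemma pi_quotM x y : \pi_quot (x * y) = quot_mul (\pi_quot x) (\pi_quot y).
Proof.
apply/quot_eqP; set x' := repr _; set y' := repr _.
rewrite (_ : _ * _ = (x^-1 * x') ^ y * (y^-1 * y')).
  apply: (group_closedM (ns_group N)); last exact: repr_quot.
  by apply: ns_conj; apply: repr_quot.
by rewrite conjgE invgM !mulgA mulgK.
Qed.

Lemma pi_quotV x : \pi_quot x^-1 = quot_inv (\pi_quot x).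
Proof.
apply/quot_eqP; set x' := repr _; rewrite invgK.
rewrite (_ : _ * _ = ((x^-1 * x')^-1) ^ x^-1).
  apply: ns_conj; apply: (group_closedV (ns_group N)); exact: repr_quot.
by rewrite conjgE !invgM !invgK !mulgA mulgK.
Qed.

Lemma quot_mulA : associative quot_mul.
Proof.
move=> u v w; elim/quot_ind: u => x; elim/quot_ind: v => y.
elim/quot_ind: w => z.
by rewrite -!pi_quotM mulgA.
Qed.
Lemma quot_mul1g : left_id quot_one quot_mul.
Proof. by move=> u; elim/quot_ind: u => x; rewrite -pi_quotM mul1g. Qed.
Lemma quot_mulg1 : right_id quot_one quot_mul.
Proof. by move=> u; elim/quot_ind: u => x; rewrite -pi_quotM mulg1. Qed.
Lemma quot_mulVg : left_inverse quot_one quot_inv quot_mul.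
Proof.
by move=> u; elim/quot_ind: u => x; rewrite -pi_quotV -pi_quotM mulVg.
Qed.
Lemma quot_mulgV : right_inverse quot_one quot_inv quot_mul.
Proof.
by move=> u; elim/quot_ind: u => x; rewrite -pi_quotV -pi_quotM mulgV.
Qed.

HB.instance Definition _ := isGroup.Build quot
  quot_mulA quot_mul1g quot_mulg1 quot_mulVg quot_mulgV.

End Quotient.

Section QuotMap.
Variables (G H : groupType) (f : {hom G -> H}).
Variables (M : normal_subgroup G) (N : normal_subgroup H).
Hypothesis fMN : forall x, x \in M -> f x \in N.

(* The homomorphism G / M -> H / N induced by f; the hypothesis is an argument
   so that the homomorphism structure can be inferred. *)
Definition quot_map of (forall x, x \in M -> f x \in N) :=
  fun u : quot M => \pi_(quot N) (f (repr u)).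

Lemma quot_mapE x : quot_map fMN (\pi_(quot M) x) = \pi_(quot N) (f x).
Proof.
by apply/esym/quot_eqP; rewrite -gmulfV -gmulfM fMN // repr_quot.
Qed.

Lemma quot_mapM : {morph quot_map fMN : u v / u * v}.
Proof.
move=> u v; elim/quot_ind: u => x; elim/quot_ind: v => y.
rewrite -[X in quot_map _ X]pi_quotM !quot_mapE.
by rewrite gmulfM; apply: pi_quotM.
Qed.

Lemma quot_map1 : quot_map fMN 1 = 1.
Proof.
by rewrite [X in quot_map _ X](erefl : 1 = \pi_(quot M) 1) quot_mapE gmulf1.
Qed.

HB.instance Definition _ := isUMagmaMorphism.Build
  (quot M) (quot N) (quot_map fMN) (pair quot_map1 quot_mapM).

End QuotMap.

Section Preimage.
Variables (G H : groupType) (f : {hom G -> H}) (N : normal_subgroup H).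

Definition preim_pred : {pred G} := [pred x | f x \in N].

Lemma preim_group : group_closed preim_pred.
Proof.
split=> [|x y]; rewrite !inE ?gmulf1 ?(ns_group N).1 //.
by move=> hx hy; rewrite gmulfF (ns_group N).2.
Qed.

Lemma preim_conj x y : x \in preim_pred -> x ^ y \in preim_pred.
Proof. by rewrite !inE gmulfJ; apply: ns_conj. Qed.

Definition preim_ns : normal_subgroup G :=
  NormalSubgroup preim_group preim_conj.

Lemma preim_nsP x : x \in preim_ns -> f x \in N.
Proof. by []. Qed.

End Preimage.

(* G / N is a finite p-group. *)
Definition p_index (p : nat) (G : groupType) (N : normal_subgroup G) : Prop :=
  exists k, ([set: quot N] #= `I_(p ^ k))%classic%card.

Lemma p_index_preim p (G H : groupType) (f : {hom G -> H})
    (N : normal_subgroup H) (g : H -> G) :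
  cancel g f -> p_index p N -> p_index p (preim_ns f N).
Proof.
move=> gK [k hk]; exists k; apply: card_eq_trans hk.
pose h := quot_map (@preim_nsP _ _ f N).
rewrite (_ : [set: quot N] = h @` setT)%classic; last first.
  apply/esym/seteqP; split=> // u _; elim/quot_ind: u => y.
  by exists (\pi_(quot (preim_ns f N)) (g y)); rewrite // /h quot_mapE gK.
rewrite card_eq_sym; apply: inj_card_eq => u v _ _.
elim/quot_ind: u => x; elim/quot_ind: v => y; rewrite /h !quot_mapE.
by move=> /quot_eqP xy; apply/quot_eqP; rewrite inE /= gmulfM gmulfV.
Qed.

Record inverse_system := InverseSystem {
  is_idx : Type;
  is_grp :> is_idx -> groupType;
  is_le : is_idx -> is_idx -> Prop;
  is_map : forall i j, is_le i j -> {hom is_grp i -> is_grp j}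
}.

Section InverseLimit.
Variable S : inverse_system.

Record inverse_limit := InverseLimit {
  il_val :> forall i, S i;
  il_compat : forall i j (ij : is_le i j), is_map ij (il_val i) = il_val j
}.

HB.instance Definition _ := gen_eqMixin inverse_limit.
HB.instance Definition _ := gen_choiceMixin inverse_limit.

Lemma il_ext (x y : inverse_limit) : (forall i, x i = y i) -> x = y.
Proof.
case: x y => [x hx] [y hy] /= xy.
have e : x = y by apply: functional_extensionality_dep.
by case: y / e hy {xy} => hy; congr InverseLimit; apply: Prop_irrelevance.
Qed.

Lemma il_one_compat i j (ij : @is_le S i j) : is_map ij 1 = 1.
Proof. exact: gmulf1. Qed.
Lemma il_mul_compat (x y : inverse_limit) i j (ij : is_le i j) :
  is_map ij (x i * y i) = x j * y j.
Proof. by rewrite gmulfM !il_compat. Qed.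
Lemma il_inv_compat (x : inverse_limit) i j (ij : is_le i j) :
  is_map ij (x i)^-1 = (x j)^-1.
Proof. by rewrite gmulfV il_compat. Qed.

Definition il_one : inverse_limit := @InverseLimit (fun i => 1) il_one_compat.
Definition il_mul (x y : inverse_limit) : inverse_limit :=
  InverseLimit (@il_mul_compat x y).
Definition il_inv (x : inverse_limit) : inverse_limit :=
  InverseLimit (@il_inv_compat x).

Lemma il_mulA : associative il_mul.
Proof. by move=> x y z; apply: il_ext => i /=; rewrite mulgA. Qed.
Lemma il_mul1g : left_id il_one il_mul.
Proof. by move=> x; apply: il_ext => i /=; rewrite mul1g. Qed.
Lemma il_mulg1 : right_id il_one il_mul.
Proof. by move=> x; apply: il_ext => i /=; rewrite mulg1. Qed.
Lemma il_mulVg : left_inverse il_one il_inv il_mul.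
Proof. by move=> x; apply: il_ext => i /=; rewrite mulVg. Qed.
Lemma il_mulgV : right_inverse il_one il_inv il_mul.
Proof. by move=> x; apply: il_ext => i /=; rewrite mulgV. Qed.

HB.instance Definition _ := isGroup.Build inverse_limit
  il_mulA il_mul1g il_mulg1 il_mulVg il_mulgV.

End InverseLimit.

Record group_action (H G : groupType) := GroupAction {
  ga_act :> H -> G -> G;
  ga_act1 : forall x, ga_act 1 x = x;
  ga_actM : forall h k x, ga_act (h * k) x = ga_act h (ga_act k x);
  ga_morph : forall h, {morph ga_act h : x y / x * y}
}.

Section SemidirectProduct.
Variables (H G : groupType) (a : group_action H G).

(* G ><| H: the second component of a pair is the one that acts. *)
Definition sdp of group_action H G : Type := (G * H)%type.

HB.instance Definition _ := Choice.copy (sdp a) (G * H)%type.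

Definition sdp_one : sdp a := (1, 1).
Definition sdp_mul (u v : sdp a) : sdp a := (u.1 * a u.2 v.1, u.2 * v.2).
Definition sdp_inv (u : sdp a) : sdp a := (a u.2^-1 u.1^-1, u.2^-1).

Lemma ga_morph1 h : a h 1 = 1.
Proof. by apply: (mulgI (a h 1)); rewrite -ga_morph !mulg1. Qed.

Lemma sdp_mulA : associative sdp_mul.
Proof. by move=> u v w; rewrite /sdp_mul /= ga_morph ga_actM !mulgA. Qed.
Lemma sdp_mul1g : left_id sdp_one sdp_mul.
Proof. by case=> x h; rewrite /sdp_mul /= ga_act1 !mul1g. Qed.
Lemma sdp_mulg1 : right_id sdp_one sdp_mul.
Proof. by case=> x h; rewrite /sdp_mul /= ga_morph1 !mulg1. Qed.
Lemma sdp_mulVg : left_inverse sdp_one sdp_inv sdp_mul.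
Proof. by case=> x h; rewrite /sdp_mul /= -ga_morph !mulVg ga_morph1. Qed.
Lemma sdp_mulgV : right_inverse sdp_one sdp_inv sdp_mul.
Proof. by case=> x h; rewrite /sdp_mul /= -ga_actM !mulgV ga_act1 mulgV. Qed.

HB.instance Definition _ := isGroup.Build (sdp a)
  sdp_mulA sdp_mul1g sdp_mulg1 sdp_mulVg sdp_mulgV.

End SemidirectProduct.

Section SdpMap.
Variables (H G K : groupType) (a : group_action H G) (b : group_action H K).
Variable f : {hom G -> K}.
Hypothesis fab : forall h x, f (a h x) = b h (f x).

Definition sdp_map of (forall h x, f (a h x) = b h (f x)) :=
  fun u : sdp a => ((f u.1, u.2) : sdp b).

Lemma sdp_mapM : {morph sdp_map fab : u v / u * v}.
Proof. by move=> [x h] [y k]; congr (_, _); rewrite /= gmulfM fab. Qed.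

Lemma sdp_map1 : sdp_map fab 1 = 1.
Proof. by congr (_, _); rewrite /= gmulf1. Qed.

HB.instance Definition _ := isUMagmaMorphism.Build
  (sdp a) (sdp b) (sdp_map fab) (pair sdp_map1 sdp_mapM).

End SdpMap.

(* 'Z_3 carries the group law given by addition, with generator Zp1. *)
Notation H3 := ('Z_3).

Section CyclicAction.
Variables (G : groupType) (s : {hom G -> G}).
Hypothesis s3 : forall x, s (s (s x)) = x.

Definition Z3_act (h : H3) (x : G) : G := iter h s x.

Lemma Z3_act1 x : Z3_act 1 x = x. Proof. by []. Qed.

Lemma Z3_actM h k x : Z3_act (h * k) x = Z3_act h (Z3_act k x).
Proof.
case: h k => [[|[|[|//]]] ?] [[|[|[|//]]] ?];
by rewrite /Z3_act /= ?s3.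
Qed.

Lemma Z3_morph h : {morph Z3_act h : x y / x * y}.
Proof.
move=> x y; rewrite /Z3_act; elim: (h : nat) => //= n ->; exact: gmulfM.
Qed.

(* The action of Z/3 in which 1 acts as s. *)
Definition Z3_action : group_action H3 G :=
  GroupAction Z3_act1 Z3_actM Z3_morph.

End CyclicAction.

Lemma Z3_action_equiv (G K : groupType) (s : {hom G -> G}) (t : {hom K -> K})
    s3 t3 (f : {hom G -> K}) : (forall x, f (s x) = t (f x)) ->
  forall h x, f (@Z3_action G s s3 h x) = @Z3_action K t t3 h (f x).
Proof. by move=> fst h x /=; rewrite /Z3_act; elim: (h : nat) => //= n <-. Qed.

Record p_subgroup (p : nat) (G : groupType) := PSubgroup {
  ps_ns :> normal_subgroup G;
  ps_index : p_index p ps_ns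
}.

Definition ns_le (G : groupType) (M N : normal_subgroup G) : Prop :=
  forall x, x \in M -> x \in N.

Section Completion.
Variables (p : nat) (G : groupType).

Definition quot_trans (M N : normal_subgroup G) (MN : ns_le M N) :
    {hom quot M -> quot N} :=
  @quot_map G G idfun M N MN.

Definition completion_system : inverse_system :=
  @InverseSystem (p_subgroup p G) (fun N => quot N) (fun M N => ns_le M N)
    (fun M N => @quot_trans M N).

Definition completion : groupType := inverse_limit completion_system.

End Completion.

Section CompletionMap.
Variables (p : nat) (s : {hom F2 -> F2}) (s' : F2 -> F2) (sK : cancel s' s).

Definition ps_preim (N : p_subgroup p F2) : p_subgroup p F2 :=
  PSubgroup (p_index_preim sK (ps_index N)).

Definition completion_map_val (x : completion p F2)
    (N : p_subgroup p F2) : quot N :=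
  quot_map (@preim_nsP _ _ s N) (x (ps_preim N)).

Lemma completion_map_compat x M N (MN : @is_le (completion_system p F2) M N) :
  is_map MN (completion_map_val x M) = completion_map_val x N.
Proof.
have MN' : @is_le (completion_system p F2) (ps_preim M) (ps_preim N).
  by move=> w; apply: MN.
rewrite /completion_map_val -(il_compat x MN') /=.
elim/quot_ind: (il_val x _) => w.
by rewrite /quot_trans !quot_mapE.
Qed.

(* The endomorphism of the completion induced by s: its component at N is the
   image of the component at s^-1(N) under F2 / s^-1(N) -> F2 / N. *)
Definition completion_map (x : completion p F2) : completion p F2 :=
  @InverseLimit (completion_system p F2) _ (@completion_map_compat x).

Lemma completion_mapM : {morph completion_map : x y / x * y}.
Proof. by move=> x y; apply: il_ext => N; apply: gmulfM. Qed.

Lemma completion_map1 : completion_map 1 = 1.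
Proof. by apply: il_ext => N; apply: gmulf1. Qed.

HB.instance Definition _ := isUMagmaMorphism.Build
  (completion p F2) (completion p F2) completion_map
  (pair completion_map1 completion_mapM).

End CompletionMap.

Lemma sigma_invK : cancel (fun w => sigma (sigma w)) sigma.
Proof. exact: sigma3. Qed.

Definition F2hat (p : nat) : groupType := completion p F2.

Definition sigma_hat (p : nat) : {hom F2hat p -> F2hat p} :=
  @completion_map p sigma _ sigma_invK.

Lemma sigma_hat3 p x : sigma_hat p (sigma_hat p (sigma_hat p x)) = x.
Proof.
apply: il_ext => N.
pose N3 : p_subgroup p F2 :=
  ps_preim sigma_invK (ps_preim sigma_invK (ps_preim sigma_invK N)).
have N3N : @is_le (completion_system p F2) N3 N.
  by move=> w wN; rewrite -[w]sigma3; apply: wN.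
have E (y : F2hat p) M : sigma_hat p y M =
  quot_map (@preim_nsP _ _ sigma M) (y (ps_preim sigma_invK M)) by [].
rewrite !E -(il_compat x N3N) /= -/N3.
elim/quot_ind: (il_val x N3) => w.
rewrite /quot_trans !(quot_mapE _ w) (quot_mapE _ (sigma w)).
by rewrite (quot_mapE _ (sigma (sigma w))) sigma3.
Qed.

Definition F2hatH3 (p : nat) : groupType := sdp (Z3_action (@sigma_hat3 p)).

Record stable_p_subgroup (p : nat) := StablePSubgroup {
  sps_ps :> p_subgroup p F2;
  sps_stable : forall w, w \in sps_ps -> sigma w \in sps_ps
}.

Section StableQuotient.
Variables (p : nat) (N : stable_p_subgroup p).

Definition quot_sigma : {hom quot N -> quot N} := quot_map (@sps_stable p N).

Lemma quot_sigma3 u : quot_sigma (quot_sigma (quot_sigma u)) = u.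
Proof.
elim/quot_ind: u => w; rewrite /quot_sigma /= (quot_mapE _ w).
by rewrite (quot_mapE _ (sigma w)) (quot_mapE _ (sigma (sigma w))) sigma3.
Qed.

(* U ><| H3 for U = F2 / N. *)
Definition quotH3 : groupType := sdp (Z3_action quot_sigma3).

End StableQuotient.

Section StableTrans.
Variables (p : nat) (M N : stable_p_subgroup p) (MN : ns_le M N).

Lemma quot_trans_equiv h u :
  quot_trans MN (Z3_action (@quot_sigma3 p M) h u)
  = Z3_action (@quot_sigma3 p N) h (quot_trans MN u).
Proof.
apply: Z3_action_equiv => {}u; elim/quot_ind: u => w.
by rewrite /quot_sigma /quot_trans /= !(quot_mapE _ w) (quot_mapE _ (sigma w)).
Qed.

Definition quotH3_trans : {hom quotH3 M -> quotH3 N} :=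
  sdp_map quot_trans_equiv.

End StableTrans.

Definition conj_class (G : groupType) (x : G) : set G :=
  [set x ^ y | y in [set: G]]%classic.

Definition generates (G : groupType) (r : nat) (g : 'I_r -> G) : Prop :=
  forall K : {pred G}, group_closed K -> (forall i, g i \in K) ->
  forall x, x \in K.

Definition nielsen_class (G : groupType) (r : nat) (C : 'I_r -> set G) :
    set ('I_r -> G) :=
  [set g | [/\ \prod_(i < r) g i = 1,
               generates g &
               exists s : 'S_r, forall i, C (s i) (g i)]]%classic.

(* The 4-tuple of classes (C, C, C', C') of G ><| H3, where C and C' are the
   conjugacy classes of (1, 1) and (1, -1). These two elements have order 3 and
   lift the two nontrivial classes of H3; for a finite p-group G with p <> 3
   their classes are the only ones with this property. *)
Definition C_pm3sq (G : groupType) (a : group_action H3 G) (i : 'I_4) :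
    set (sdp a) :=
  conj_class ((1, if i < 2 then Zp1 else Zp1^-1) : sdp a).

(* Infinite projective systems of distinct finite p-group quotients F2 / N_i by
   H3-stable normal subgroups; the transition maps are the projections
   F2 / N_i -> F2 / N_j for N_i contained in N_j. *)
Record proj_system (p : nat) := ProjSystem {
  pj_idx : Type;
  pj_sub : pj_idx -> stable_p_subgroup p;
  pj_infinite : infinite_set [set: pj_idx]%classic;
  pj_distinct : forall i j, pj_sub i =i pj_sub j -> i = j;
  pj_directed : forall i j,
    exists k, ns_le (pj_sub k) (pj_sub i) /\ ns_le (pj_sub k) (pj_sub j)
}.

Section LimitGroup.
Variables (p : nat) (I : proj_system p).

Definition pj_system : inverse_system :=
  @InverseSystem (pj_idx I) (fun i => quotH3 (pj_sub i))
    (fun i j => ns_le (pj_sub i) (pj_sub j))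
    (fun i j ij => quotH3_trans ij).

Definition limit_group : groupType := inverse_limit pj_system.

Definition limit_proj_val (u : F2hatH3 p) (i : pj_idx I) :
    quotH3 (pj_sub i) :=
  (il_val u.1 (pj_sub i : p_subgroup p F2), u.2).

Lemma limit_proj_compat u i j (ij : @is_le pj_system i j) :
  is_map ij (limit_proj_val u i) = limit_proj_val u j.
Proof.
congr (_, _); exact: (@il_compat (completion_system p F2) u.1 _ _ ij).
Qed.

Definition limit_proj (u : F2hatH3 p) : limit_group :=
  @InverseLimit pj_system _ (@limit_proj_compat u).

Lemma proj_action (N : stable_p_subgroup p) h (x : F2hat p) :
  il_val (Z3_action (@sigma_hat3 p) h x) (N : p_subgroup p F2)
  = Z3_action (@quot_sigma3 p N) h (il_val x (N : p_subgroup p F2)).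
Proof.
rewrite /= /Z3_act; elim: (h : nat) => //= n <-.
move: (iter n _ x) => y {x h n}.
have NN' : @is_le (completion_system p F2) N (ps_preim sigma_invK N).
  by move=> w /= wN; rewrite inE /= sps_stable.
rewrite /= /completion_map_val -(il_compat y NN') /=.
elim/quot_ind: (il_val y _) => w.
by rewrite /quot_trans /quot_sigma /= !(quot_mapE _ w).
Qed.

Lemma limit_projM : {morph limit_proj : u v / u * v}.
Proof.
move=> u v; apply: il_ext => i; congr (_, _).
by rewrite -proj_action.
Qed.

Lemma limit_proj1 : limit_proj 1 = 1.
Proof. exact: il_ext. Qed.

HB.instance Definition _ := isUMagmaMorphism.Build
  (F2hatH3 p) limit_group limit_proj (pair limit_proj1 limit_projM).

End LimitGroup.

(* No topology is recorded: the maps limit_proj are continuous surjections of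
   compact Hausdorff groups, so that a homomorphism between two groups
   limit_group I that is compatible with these projections is automatically
   continuous. *)
Record pro_quotient (p : nat) := QuotientGroup {
  qt_grp :> groupType;
  qt_proj : {hom F2hatH3 p -> qt_grp};
  qt_surj : forall y, exists x, qt_proj x = y
}.

(* Q is larger than Q': Q' is a quotient of Q. *)
Definition larger (p : nat) (Q Q' : pro_quotient p) : Prop :=
  exists f : {hom Q -> Q'}, forall x, f (qt_proj Q x) = qt_proj Q' x.

Definition same_quotient (p : nat) (Q Q' : pro_quotient p) : Prop :=
  exists f : {hom Q -> Q'},
    bijective f /\ forall x, f (qt_proj Q x) = qt_proj Q' x.

Definition nielsen_quotient (p : nat) (Q : pro_quotient p) : Prop :=
  exists I : proj_system p,
    (forall i : pj_idx I, nielsen_class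
       (@C_pm3sq _ (Z3_action (@quot_sigma3 p (pj_sub i)))) !=set0)%classic /\
    exists f : {hom Q -> limit_group I},
      bijective f /\ forall x, f (qt_proj Q x) = limit_proj I x.

Definition nielsen_class_limit (p : nat) (Q : pro_quotient p) : Prop :=
  nielsen_quotient Q /\
  forall Q' : pro_quotient p, nielsen_quotient Q' -> larger Q' Q ->
    same_quotient Q' Q.

Lemma id_surj (G : groupType) (y : G) : exists x, idfun x = y.
Proof. by exists y. Qed.

Definition full_quotient (p : nat) : pro_quotient p :=
  @QuotientGroup p (F2hatH3 p) idfun (@id_surj (F2hatH3 p)).

(* Main.v *)
(* Stable subgroups are cofinal: if N has p-power index, so has the
   intersection of N, sigma^-1 N and sigma^-2 N. Hence the limit over all
   stable N is F2hat ><| H3, and every other Nielsen limit is a quotient of it,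
   so only the Nielsen classes at finite level are at stake. With
   t = (1, Zp1) and a = x1 t, the tuple (a, t, t^-1, a^-1) has product 1 and
   generates, since it yields x1 and sigma x1 = x2^-1. Finally a is conjugate to
   t in U ><| H3: as x1 sigma(x1) sigma^2(x1) = 1, the map
   v |-> sigma(v) x1^-1 permutes the p-group U with order dividing 3, so it has
   a fixed point v when p <> 3, and then x1 = v^-1 sigma(v). *)
From HB Require Import structures.
From mathcomp Require Import boolp classical_sets functions cardinality.
From mathcomp Require Import all_boot fingroup perm zmodp gproduct action cyclic.
From mathcomp Require Import pgroup sylow.
Require Import Defs.
Import generic_quotient.

Set Implicit Arguments.
Unset Strict Implicit.
Unset Printing Implicit Defensive.

Local Open Scope group_scope.
Local Open Scope quotient_scope.

(** * Bijections, inverse homomorphisms, transport of group laws *)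

Lemma card_eq_bijective (T U : Type) :
  ([set: T] #= [set: U])%classic%card -> exists f : T -> U, bijective f.
Proof.
move=> /card_bijP[f [g fK gK]].
exists (fun x => set_val (f (to_setT x))).
exists (fun y => set_val (g (to_setT y))) => x.
  by rewrite (_ : to_setT _ = f (to_setT x)) ?fK //; apply: val_inj.
by rewrite (_ : to_setT _ = g (to_setT x)) ?gK //; apply: val_inj.
Qed.

Lemma inj_surj_card_eq (T U : Type) (f : T -> U) :
  injective f -> (forall y, exists x, f x = y) ->
  ([set: T] #= [set: U])%classic%card.
Proof.
move=> fI fS; rewrite card_eq_sym (_ : [set: U] = f @` [set: T])%classic.
  by apply: inj_card_eq => x y _ _; apply: fI.
by apply/esym/seteqP; split=> // y _; have [x <-] := fS y; exists x.
Qed.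

Lemma hom_inv (G H : groupType) (f : {hom G -> H}) : bijective f ->
  exists g : {hom H -> G}, cancel f g /\ cancel g f.
Proof.
case=> g fK gK.
have g1 : g 1 = 1 by rewrite -(gmulf1 (s := f)) fK.
have gM : {morph g : x y / x * y}.
  by move=> x y; apply: (can_inj fK); rewrite gK gmulfM !gK.
pose gh := isUMagmaMorphism.Build H G g (pair g1 gM).
pose g' : {hom H -> G} := HB.pack g gh.
by exists g'.
Qed.

Section Transport.
Variables (H : groupType) (T : finType) (e : T -> H) (e' : H -> T).
Hypotheses (eK : cancel e e') (e'K : cancel e' e).

(** [quot N] is only a [groupType]; moving its law along a bijection to some ['I_n] gives a
    [finGroupType]. The cancellation proofs are parameters so that the instance is found from the
    type. *)
Definition transported of cancel e e' & cancel e' e : Type := T.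
Local Notation tT := (transported eK e'K).
HB.instance Definition _ := Finite.copy tT T.

Let t1 : tT := e' 1.
Let tM (x y : tT) : tT := e' (e x * e y).
Let tV (x : tT) : tT := e' (e x)^-1.
Let tA : associative tM.
Proof. by move=> x y z; rewrite /tM !e'K mulgA. Qed.
Let t1g : left_id t1 tM.
Proof. by move=> x; rewrite /tM /t1 !e'K mul1g eK. Qed.
Let tVg : left_inverse t1 tV tM.
Proof. by move=> x; rewrite /tM /t1 !e'K mulVg. Qed.
HB.instance Definition _ := Finite_isGroup.Build tT tA t1g tVg.

Definition to_transported (x : H) : tT := e' x.
Let to1 : to_transported 1 = 1. Proof. by []. Qed.
Let toM : {morph to_transported : x y / x * y}.
Proof. by move=> x y; congr e'; rewrite !e'K. Qed.
HB.instance Definition _ := isUMagmaMorphism.Build H tT to_transported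
  (pair to1 toM).
End Transport.

Definition quot_pi (G : groupType) (N : normal_subgroup G) (x : G) : quot N :=
  \pi_(quot N) x.

Section QuotPi.
Variables (G : groupType) (N : normal_subgroup G).
Let pi1 : quot_pi N 1 = 1. Proof. by []. Qed.
Let piM : {morph quot_pi N : x y / x * y}. Proof. exact: pi_quotM. Qed.
HB.instance Definition _ := isUMagmaMorphism.Build G (quot N) (quot_pi N)
  (pair pi1 piM).

Lemma quot_pi_eq1 x : (quot_pi N x == 1) = (x \in N).
Proof.
apply/eqP/idP => [/esym/quot_eqP|xN]; first by rewrite invg1 mul1g.
by apply/esym/quot_eqP; rewrite invg1 mul1g.
Qed.
End QuotPi.

(** * Subgroups of p-power index and fixed points *)

Lemma p_index_bij p (G : groupType) (N : normal_subgroup G) : p_index p N ->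
  exists k (e : quot N -> 'I_(p ^ k)), bijective e.
Proof.
case=> k hk; exists k; apply: card_eq_bijective.
exact: card_eq_trans hk card_II.
Qed.

(** Kernels are easier to build and to intersect than cardinals of quotients. Forwards, [f] is the
    projection to the transported quotient; backwards, [quot N] is in bijection with the image of
    [f], a subgroup of a p-group. *)
Lemma p_index_kerP p (G : groupType) (N : normal_subgroup G) : prime p ->
  p_index p N <-> exists (gT : finGroupType) (f : {hom G -> gT}),
    p.-group [set: gT] /\ forall x, (x \in N) = (f x == 1).
Proof.
move=> p_pr; split=> [/p_index_bij[k [e [e' eK e'K]]]|[gT [f [pT fN]]]].
  pose f : {hom G -> _} := to_transported e'K eK \o quot_pi N.
  exists _, f; split=> [|x].
    by rewrite /pgroup cardsT card_ord pnatX pnat_id.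
  rewrite -quot_pi_eq1 /f /= -(gmulf1 (s := to_transported e'K eK)).
  by rewrite (inj_eq (can_inj eK)).
pose A := [set y | `[<exists x, f x = y>]].
have gA : group_set A.
  apply/group_setP; split=> [|x y].
    by rewrite inE; apply/asboolP; exists 1; rewrite gmulf1.
  rewrite !inE => /asboolP[u <-] /asboolP[v <-]; apply/asboolP.
  by exists (u * v); rewrite gmulfM.
have /p_natP[k hk] : p.-nat #|A|.
  exact: (@pgroupS _ _ [set: gT]%G (Group gA) (subsetT _) pT).
exists k; rewrite -hk.
have fA x : f x \in A by rewrite inE; apply/asboolP; exists x.
pose h (u : quot N) : 'I_#|A| := enum_rank_in (fA 1) (f (repr u)).
have hE u : enum_val (h u) = f (repr u) by rewrite enum_rankK_in.
apply: card_eq_trans (inj_surj_card_eq (f := h) _ _) _.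
- move=> u v /(congr1 enum_val); rewrite !hE => fuv.
  rewrite -[u]reprK -[v]reprK; apply/quot_eqP.
  by rewrite fN gmulfM gmulfV fuv mulVg.
- move=> i; have := enum_valP i; rewrite inE => /asboolP[x fx].
  exists (quot_pi N x); apply: enum_val_inj; rewrite hE -fx.
  have := repr_quot N x; rewrite fN gmulfM gmulfV => /eqP.
  by move/(canRL (mulKVg _)); rewrite mulg1.
by rewrite card_eq_sym; exact: card_II.
Qed.

(** The permutation [f] generates a 3-group, so its number of fixed points is congruent to [#|T|]
    modulo 3, hence nonzero. *)
Lemma fixpoint_order3 (T : finType) (f : T -> T) :
  (forall x, f (f (f x)) = x) -> ~~ (3 %| #|T|) -> exists x, f x = x.
Proof.
move=> f3 nT; have fI : injective f by move=> x y e; rewrite -[x]f3 e f3.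
pose s := perm fI.
have s3 : 3.-group <[s]>.
  rewrite /pgroup -orderE; apply: (pnat_dvd (n := 3)) => //.
  rewrite order_dvdn; apply/eqP/permP => x.
  by rewrite expgS expgS expg1 !permM !permE f3.
have sT : [acts <[s]>, on [set: T] | 'P].
  by apply/actsP=> a _ x; rewrite !inE.
have := pgroup_fix_mod s3 sT; rewrite cardsT => e.
have : #|'Fix_([set: T] | 'P)(<[s]>)| != 0.
  by apply: contraNneq nT => F0; rewrite /dvdn e F0 mod0n.
rewrite cards_eq0 => /set0Pn[x]; rewrite setTI afix_cycle => /afix1P /= fx.
by exists x; rewrite -[RHS]fx /aperm permE.
Qed.

Section Intersection.
Variables (G : groupType) (M N : normal_subgroup G).

Definition nsI_pred : {pred G} := [pred x | (x \in M) && (x \in N)].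

Lemma nsI_group : group_closed nsI_pred.
Proof.
split=> [|x y]; rewrite !inE ?(ns_group M).1 ?(ns_group N).1 //.
by move=> /andP[? ?] /andP[? ?]; rewrite (ns_group M).2 ?(ns_group N).2.
Qed.

Lemma nsI_conj x y : x \in nsI_pred -> x ^ y \in nsI_pred.
Proof. by rewrite !inE => /andP[? ?]; rewrite !ns_conj. Qed.

Definition nsI : normal_subgroup G := NormalSubgroup nsI_group nsI_conj.

Lemma in_nsI x : (x \in nsI) = (x \in M) && (x \in N).
Proof. by []. Qed.
End Intersection.

Section PairHom.
Variables (G : groupType) (gT1 gT2 : finGroupType).
Variables (f : {hom G -> gT1}) (g : {hom G -> gT2}).

Definition pair_hom (x : G) : gT1 * gT2 := (f x, g x).

Let pair_hom1 : pair_hom 1 = 1.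
Proof. by rewrite /pair_hom !gmulf1. Qed.
Let pair_homM : {morph pair_hom : x y / x * y}.
Proof. by move=> x y; rewrite /pair_hom !gmulfM. Qed.
HB.instance Definition _ := isUMagmaMorphism.Build G (gT1 * gT2)%type pair_hom
  (pair pair_hom1 pair_homM).
End PairHom.

(** The intersection is the kernel of the pair map into a product of two p-groups. *)
Lemma p_index_nsI p (G : groupType) (M N : normal_subgroup G) : prime p ->
  p_index p M -> p_index p N -> p_index p (nsI M N).
Proof.
move=> p_pr /(p_index_kerP _ p_pr)[gT1 [f [pT1 fM]]].
move=> /(p_index_kerP _ p_pr)[gT2 [g [pT2 gN]]].
apply/(p_index_kerP _ p_pr); exists _, (pair_hom f g); split=> [|x].
  by move: pT1 pT2; rewrite /pgroup !cardsT card_prod pnatM => -> ->.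
by rewrite in_nsI fM gN.
Qed.

Section Kernel.
Variables (G H : groupType) (f : {hom G -> H}).

Definition ker_pred : {pred G} := [pred x | f x == 1].

Lemma ker_group : group_closed ker_pred.
Proof.
split=> [|x y]; rewrite !inE ?gmulf1 //.
by move=> /eqP fx /eqP fy; rewrite gmulfF fx fy divg1.
Qed.

Lemma ker_conj x y : x \in ker_pred -> x ^ y \in ker_pred.
Proof. by rewrite !inE gmulfJ => /eqP->; rewrite conj1g. Qed.

Definition ker_ns : normal_subgroup G := NormalSubgroup ker_group ker_conj.

Lemma in_ker_ns x : (x \in ker_ns) = (f x == 1).
Proof. by []. Qed.
End Kernel.

(** * The projective system of all stable subgroups *)

Section StableCore.
Variables (p : nat) (p_pr : prime p).

Definition psI (M N : p_subgroup p F2) : p_subgroup p F2 :=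
  PSubgroup (p_index_nsI p_pr (ps_index M) (ps_index N)).

Lemma stable_psI (M N : stable_p_subgroup p) w :
  w \in psI M N -> sigma w \in psI M N.
Proof. by rewrite !in_nsI => /andP[? ?]; rewrite !sps_stable. Qed.

Definition spsI (M N : stable_p_subgroup p) : stable_p_subgroup p :=
  StablePSubgroup (@stable_psI M N).

(** The largest sigma-stable subgroup contained in [N]. *)
Definition core_ps (N : p_subgroup p F2) : p_subgroup p F2 :=
  psI N (psI (ps_preim sigma_invK N)
    (ps_preim sigma_invK (ps_preim sigma_invK N))).

Lemma in_core_ps N w :
  (w \in core_ps N) = [&& w \in N, sigma w \in N & sigma (sigma w) \in N].
Proof. by []. Qed.

Lemma core_ps_stable N w : w \in core_ps N -> sigma w \in core_ps N.
Proof. by rewrite !in_core_ps sigma3 => /and3P[-> -> ->]. Qed.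

Definition core (N : p_subgroup p F2) : stable_p_subgroup p :=
  StablePSubgroup (@core_ps_stable N).

Lemma core_le N : ns_le (core N) N.
Proof. by move=> w /and3P[]. Qed.

(** The exponent sum of [x1] modulo [m], a source of infinitely many distinct stable subgroups. *)
Definition expsum_x1 (m : nat) : {hom F2 -> 'Z_m} :=
  fg_lift (fun t : 'I_2 => if t == ord0 then Zp1 else 1).

(** The exponent [m.+1] keeps the modulus above 1, since ['Z_1] has two elements. *)
Lemma expsum_x1_p_index m : p_index p (ker_ns (expsum_x1 (p ^ m.+1))).
Proof.
apply/(p_index_kerP _ p_pr); exists _, (expsum_x1 (p ^ m.+1)); split=> //.
rewrite /pgroup cardsT card_ord Zp_cast ?pnatX ?pnat_id //.
by rewrite -{1}(expn0 p) ltn_exp2l // prime_gt1.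
Qed.

Definition expsum_x1_core m : stable_p_subgroup p :=
  core (PSubgroup (expsum_x1_p_index m)).

Lemma expsum_x1_coreE m n : (x1 ^+ n \in expsum_x1_core m) = (p ^ m.+1 %| n).
Proof.
have p_gt1 : 1 < p ^ m.+1 by rewrite -{1}(expn0 p) ltn_exp2l // prime_gt1.
have e1 : expsum_x1 (p ^ m.+1) x1 = Zp1 by exact: fg_lift_gen.
have e2 : expsum_x1 (p ^ m.+1) x2 = 1 by exact: fg_lift_gen.
(* The exponent sums of x1, sigma x1 = x2^-1 and sigma^2 x1 = x2 x1^-1 are 1, 0 and -1, so the three
   conditions reduce to one. *)
rewrite [LHS]in_core_ps !in_ker_ns !gmulfXn sigma_x1 !gmulfV sigma_x2.
rewrite gmulfM gmulfV !e1 !e2 invg1 mulg1 expg1n eqxx andTb expVgn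
  invg_eq1 andbb.
by rewrite -order_dvdn order_Zp1 {1}Zp_cast.
Qed.

(** The power of x1 with exponent p^(l+1) lies in [expsum_x1_core m] exactly when m <= l. *)
Lemma expsum_x1_core_inj m n : expsum_x1_core m =i expsum_x1_core n -> m = n.
Proof.
move=> e; have dvd k l : (p ^ k.+1 %| p ^ l.+1) = (k <= l).
  by rewrite dvdn_Pexp2l ?prime_gt1.
apply/eqP; rewrite eqn_leq -!dvd -!expsum_x1_coreE.
by rewrite e -[X in _ && X]e !expsum_x1_coreE !dvdnn.
Qed.

(* The index set consists of membership predicates rather than of records
   stable_p_subgroup, because distinct records can have the same elements. *)
Definition stable_idx := {P : {pred F2} |
  exists N : stable_p_subgroup p, P = N :> {pred F2}}.

Definition idx_sub (i : stable_idx) : stable_p_subgroup p :=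
  projT1 (cid (proj2_sig i)).

Definition idx_of (N : stable_p_subgroup p) : stable_idx :=
  exist _ (N : {pred F2}) (ex_intro _ N erefl).

Lemma idx_subE i : proj1_sig i = idx_sub i :> {pred F2}.
Proof. by rewrite /idx_sub; case: (cid _). Qed.

Lemma idx_ofK (N : stable_p_subgroup p) : idx_sub (idx_of N) = N :> {pred F2}.
Proof. by rewrite -idx_subE. Qed.

Lemma idx_of_le (N : stable_p_subgroup p) : ns_le (idx_sub (idx_of N)) N.
Proof. by move=> w; rewrite idx_ofK. Qed.

Lemma idx_distinct i j : idx_sub i =i idx_sub j -> i = j.
Proof.
move=> ij; have e : proj1_sig i = proj1_sig j.
  rewrite !idx_subE; apply/functional_extensionality_dep => w; exact: ij.
by case: i j e {ij} => [P hP] [Q hQ] /= e; apply: eq_exist.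
Qed.

Lemma idx_directed i j : exists k,
  ns_le (idx_sub k) (idx_sub i) /\ ns_le (idx_sub k) (idx_sub j).
Proof.
by exists (idx_of (spsI (idx_sub i) (idx_sub j))); split=> w;
  rewrite idx_ofK in_nsI => /andP[].
Qed.

Lemma idx_infinite : infinite_set [set: stable_idx]%classic.
Proof.
pose f m := idx_of (expsum_x1_core m).
have fI : injective f.
  by move=> m n [e]; apply: expsum_x1_core_inj => w; rewrite -!topredE /= e.
apply/infiniteP/(card_le_trans (B := (f @` [set: nat])%classic)).
  have : (f @` [set: nat] #= [set: nat])%classic%card.
    by apply: inj_card_eq => m n _ _ /fI.
  by rewrite card_eq_le => /andP[].
exact: subset_card_le.
Qed.

Definition all_stable : proj_system p :=
  ProjSystem idx_infinite idx_distinct idx_directed.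

End StableCore.

(** * Generation of free groups; factors of semidirect products *)

Lemma free_group_ind (T : choiceType) (K : {pred free_group T}) :
  group_closed K -> (forall t, fgen t \in K) -> forall w, w \in K.
Proof.
move=> gK genK [w rw]; elim: w rw => [|[t b] w IH] rw.
  by rewrite (_ : FreeGroup rw = 1) ?gK.1 //; apply: val_inj.
have rw' : reduced w := path_sorted rw.
pose g : free_group T := if b then (fgen t)^-1 else fgen t.
rewrite (_ : FreeGroup rw = g * FreeGroup rw').
  apply: (group_closedM gK); last exact: IH.
  by rewrite /g; case: b {rw g}; rewrite ?(group_closedV gK).
by apply: val_inj; rewrite /g; case: b rw {g} => rw /=;
  case: w rw rw' {IH} => //= c w /andP[/negPf-> _].
Qed.

Section SdpFactors.
Variables (H G : groupType) (b : group_action H G).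

Lemma sdp_ext (u v : sdp b) : u.1 = v.1 -> u.2 = v.2 -> u = v.
Proof. by case: u v => ? ? [? ?] /= -> ->. Qed.

(* Bare pairs would be multiplied in the direct product G * H. *)
Definition sdp_inl (x : G) : sdp b := (x, 1).
Definition sdp_inr (h : H) : sdp b := (1, h).

Let inl1 : sdp_inl 1 = 1. Proof. by []. Qed.
Let inlM : {morph sdp_inl : x y / x * y}.
Proof. by move=> x y; apply: sdp_ext; rewrite /= ?ga_act1 ?mulg1. Qed.
HB.instance Definition _ := isUMagmaMorphism.Build G (sdp b) sdp_inl
  (pair inl1 inlM).

Let inr1 : sdp_inr 1 = 1. Proof. by []. Qed.
Let inrM : {morph sdp_inr : h k / h * k}.
Proof. by move=> h k; apply: sdp_ext; rewrite /= ?ga_morph1 ?mulg1. Qed.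
HB.instance Definition _ := isUMagmaMorphism.Build H (sdp b) sdp_inr
  (pair inr1 inrM).

Lemma sdp_decomp (u : sdp b) : u = sdp_inl u.1 * sdp_inr u.2.
Proof. by apply: sdp_ext; rewrite /= ?ga_act1 ?mulg1 ?mul1g. Qed.

Lemma sdp_inr_conj h x :
  sdp_inr h * sdp_inl x * (sdp_inr h)^-1 = sdp_inl (b h x).
Proof.
rewrite -gmulfV; apply: sdp_ext; rewrite /= ?mulg1 ?mulgV //.
by rewrite mul1g ga_morph1 mulg1.
Qed.

(** Turns conjugacy of x1 t and t into the equation v^-1 sigma(v) = x1. *)
Lemma sdp_inl_conj h x :
  sdp_inr h ^ sdp_inl x = sdp_inl (x^-1 * b h x) * sdp_inr h.
Proof.
rewrite conjgE -gmulfV; apply: sdp_ext; rewrite /= ?mulg1 ?mul1g //.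
by rewrite !ga_act1 mulg1.
Qed.

End SdpFactors.

(** * Nielsen classes at finite level *)

Section Nielsen.
Variables (p : nat) (p_pr : prime p) (p_neq3 : p <> 3).
Variable N : stable_p_subgroup p.

Local Notation U := (quot N).
Local Notation s := (quot_sigma N).
Local Notation UH := (quotH3 N).

Let x1N : U := quot_pi N x1.

Let sE w : s (quot_pi N w) = quot_pi N (sigma w).
Proof. exact: quot_mapE. Qed.

Let x1N_norm : x1N * s x1N * s (s x1N) = 1.
Proof.
rewrite /x1N !sE -!gmulfM -[RHS](gmulf1 (s := quot_pi N)); congr quot_pi.
by rewrite sigma_x1 gmulfV sigma_x2 mulgV.
Qed.

(** A case of the vanishing of H^1(H_3, U) for U of order prime to 3. Solutions are the fixed points
    of [phi], and [x1N_norm] gives phi^3 = 1. *)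
Lemma x1N_coboundary : exists v : U, v^-1 * s v = x1N.
Proof.
pose phi v := s v * x1N^-1.
have phi3 v : phi (phi (phi v)) = v.
  rewrite /phi !gmulfM !gmulfV quot_sigma3.
  by rewrite -!mulgA -!invgM x1N_norm invg1 mulg1.
have [k [e [e' eK e'K]]] := p_index_bij (ps_index N).
have f3 i : (e \o phi \o e') ((e \o phi \o e') ((e \o phi \o e') i)) = i.
  by rewrite /= !eK phi3 e'K.
have [|i /= fi] := fixpoint_order3 f3.
  apply/negP; rewrite card_ord Euclid_dvdX // dvdn_prime2 //.
  by case/andP=> /eqP e3; case: p_neq3.
exists (e' i).
have e'i : phi (e' i) = e' i by apply: (can_inj eK); rewrite fi e'K.
by apply: (mulgI (e' i)); rewrite mulKVg -[in RHS]e'i mulgVK.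
Qed.

Lemma nielsen_nonempty :
  (nielsen_class (@C_pm3sq _ (Z3_action (@quot_sigma3 p N))) !=set0)%classic.
Proof.
pose act := Z3_action (@quot_sigma3 p N).
have [v vE] := x1N_coboundary.
pose t : UH := sdp_inr act Zp1; pose a : UH := sdp_inl act x1N * t.
have ta : t ^ sdp_inl act v = a by rewrite /t sdp_inl_conj /a -vE.
pose g (i : 'I_4) : UH := nth 1 [:: a; t; t^-1; a^-1] i.
exists g; split.
- by rewrite !big_ord_recl big_ord0 /g /= mulg1 !mulgA mulgK mulgV.
- move=> K gK Kg.
  have Ka : a \in K := Kg ord0.
  have Kt : t \in K := Kg (lift ord0 ord0).
  (* [K'] is a subgroup, stable under sigma because conjugation by t acts as sigma. It contains x1,
     as a t^-1 lies in [K], hence also x2 = (sigma x1)^-1. *)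
  pose K' : {pred F2} := [pred w | sdp_inl act (quot_pi N w) \in K].
  have K's w : w \in K' -> sigma w \in K'.
    rewrite !inE -sE -(sdp_inr_conj act Zp1) => Kw.
    by apply: gK.2 => //; apply: (group_closedM gK).
  have gK' : group_closed K'.
    by split=> [|w z]; rewrite !inE ?gmulf1 ?gmulfF; [exact: gK.1|exact: gK.2].
  have K'x1 : x1 \in K' by rewrite inE -[sdp_inl _ _](mulgK t); apply: gK.2.
  have K'x2 : x2 \in K'.
    by rewrite -[x2]invgK -sigma_x1; apply/(group_closedV gK')/K's.
  have K'T : forall w, w \in K'.
    apply: free_group_ind => // -[[|[|//]] li].
      by rewrite (_ : Ordinal li = ord0) //; apply: val_inj.
    by rewrite (_ : Ordinal li = ord_max) //; apply: val_inj.
  move=> u; rewrite [u]sdp_decomp; apply: (group_closedM gK).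
    by elim/quot_ind: u.1 => w; apply: K'T.
  (* [u.2] is a power of [Zp1], so its image under [sdp_inr] is a power of t. *)
  rewrite -[u.2]Zp1_expgz gmulfXn; elim: (u.2 : nat) => [|n IH].
    exact: gK.1.
  by rewrite expgS; apply: (group_closedM gK).
(* The tuple already lists the classes in the order of [C_pm3sq]. *)
- exists 1 => i; rewrite perm1 /C_pm3sq /conj_class /=.
  case: i => [[|[|[|[|//]]]] ?] /=.
  + by exists (sdp_inl act v).
  + by exists 1; rewrite // conjg1.
  + by exists 1; rewrite // conjg1 /g /= /t -gmulfV.
  + by exists (sdp_inl act v); rewrite // /g /= -ta -conjVg /t -gmulfV.
Qed.
End Nielsen.

(** * Comparison of the full group with the limit over stable subgroups *)

Lemma quot_trans_comp (G : groupType) (A B C : normal_subgroup G)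
    (AB : ns_le A B) (BC : ns_le B C) (AC : ns_le A C) u :
  quot_trans BC (quot_trans AB u) = quot_trans AC u.
Proof.
elim/quot_ind: u => w.
have E (M N : normal_subgroup G) (MN : ns_le M N) :
    quot_trans MN (\pi_(quot M) w) = \pi_(quot N) w := quot_mapE _ w.
by rewrite !E.
Qed.

Section LimitProj.
Variables (p : nat) (p_pr : prime p).
Local Notation I := (all_stable p_pr).
Local Notation ix := (idx_of (p:=p)).

Lemma idx_core_le (N : p_subgroup p F2) : ns_le (idx_sub (ix (core p_pr N))) N.
Proof. by move=> w /idx_of_le /core_le. Qed.

Lemma limit_proj_inj : injective (limit_proj I).
Proof.
move=> [u h] [v k] uv.
have E i : limit_proj I (u, h) i = limit_proj I (v, k) i by rewrite uv.
(* The H3 components can be compared at any index; this one is at hand. The components at [N] are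
   then compared at the core of [N]. *)
have /(congr1 snd)/= -> := E (ix (expsum_x1_core p_pr 0)).
congr (_, _); apply: il_ext => N.
pose j := ix (core p_pr N).
have jN : @is_le (completion_system p F2) (idx_sub j) N := @idx_core_le N.
rewrite -(il_compat u jN) -(il_compat v jN).
by have /(congr1 fst)/= -> := E j.
Qed.

(** The component at [N] is read off [y] at the core of [N]. By directedness every index below [N]
    gives the same value ([xE]), whence compatibility. *)
Lemma limit_proj_surj (y : limit_group I) : exists u, limit_proj I u = y.
Proof.
pose j (N : p_subgroup p F2) := ix (core p_pr N).
have jN N : ns_le (idx_sub (j N)) N := @idx_core_le N.
have cmp1 (i k : stable_idx p) (ik : ns_le (idx_sub i) (idx_sub k)) :
    quot_trans ik (y i).1 = (y k).1.
  by rewrite -(@il_compat _ y i k ik).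
have cmp2 (i k : stable_idx p) : (y i).2 = (y k).2.
  have [l [li lk]] := idx_directed p_pr i k.
  by rewrite -(@il_compat _ y l i li) -(@il_compat _ y l k lk).
pose x (N : p_subgroup p F2) : quot N := quot_trans (jN N) (y (j N)).1.
have xE i (N : p_subgroup p F2) (iN : ns_le (idx_sub i) N) :
    x N = quot_trans iN (y i).1.
  have [l [li lj]] := idx_directed p_pr i (j N).
  have lN : ns_le (idx_sub l) N by move=> w /li /iN.
  by rewrite /x -(cmp1 _ _ li) -(cmp1 _ _ lj) !(quot_trans_comp _ _ lN).
have xc M N (MN : @is_le (completion_system p F2) M N) : is_map MN (x M) = x N.
  have jMN : ns_le (idx_sub (j M)) N by move=> w /jN /MN.
  by rewrite (xE _ _ jMN) /= quot_trans_comp.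
pose xh : F2hat p := @InverseLimit (completion_system p F2) x xc.
exists ((xh, (y (j (expsum_x1_core p_pr 0))).2) : F2hatH3 p).
apply: il_ext => i; rewrite [RHS]surjective_pairing.
congr (_, _); last exact: cmp2.
have ii : ns_le (idx_sub i) (idx_sub i) by move=> w.
by rewrite -[RHS](cmp1 _ _ ii); apply: xE.
Qed.

Lemma limit_proj_bij : bijective (limit_proj I).
Proof.
have [g gK] := choice limit_proj_surj.
by exists g => // x; apply: limit_proj_inj; rewrite gK.
Qed.
End LimitProj.

(** * Maximality and uniqueness *)

Lemma full_nielsen_quotient p : prime p -> p <> 3 ->
  nielsen_quotient (full_quotient p).
Proof.
move=> p_pr p3; exists (all_stable p_pr); split=> [i|].
  exact: nielsen_nonempty.
by exists (limit_proj (all_stable p_pr)); split; first exact: limit_proj_bij.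
Qed.

(** The projection of [full_quotient p] is the identity, so [f] is a left inverse of [qt_proj Q];
    surjectivity of the latter makes it two-sided. *)
Lemma larger_full (p : nat) (Q : pro_quotient p) :
  larger Q (full_quotient p) -> same_quotient Q (full_quotient p).
Proof.
case=> f fE; exists f; split=> //.
exists (qt_proj Q) => x; last exact: fE.
by have [z <-] := qt_surj x; rewrite fE.
Qed.

Lemma full_larger (p : nat) (Q : pro_quotient p) : larger (full_quotient p) Q.
Proof. by exists (qt_proj Q). Qed.

Lemma same_quotient_sym (p : nat) (Q Q' : pro_quotient p) :
  same_quotient Q Q' -> same_quotient Q' Q.
Proof.
move=> [f [/hom_inv[g [fK gK]] fE]]; exists g; split; first by exists f.
by move=> x; rewrite -fE fK.
Qed.

Theorem proposition6p5 (p : nat) (p_prime : prime p) (p_neq3 : p <> 3) :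
  nielsen_class_limit (full_quotient p) /\
  forall Q : pro_quotient p, nielsen_class_limit Q ->
    same_quotient Q (full_quotient p).
Proof.
have fullN := full_nielsen_quotient p_prime p_neq3.
split; first by split=> // Q _; apply: larger_full.
(* Maximality of [Q] is tested against the full quotient, which is larger than every [Q]. *)
move=> Q [_ maxQ]; apply/same_quotient_sym/maxQ => //.
exact: full_larger.
Qed.
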